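(* For every $\varepsilon>0$ there exists $f_0$ such that the following holds. Let $f$ be a real number and $\Delta$ a positive integer with $f_0\le f\le \Delta^2+1$, and let $G$ be a graph on $n$ vertices of maximum degree $\Delta$ in which, for every vertex $v$, the subgraph induced by the neighbourhood $N(v)$ has at most $\Delta^2/f$ edges. Then (i) an independent set of $G$ drawn uniformly at random from the set of all independent sets of $G$ (including the empty set) has at least $(1/2-\varepsilon)(n/\Delta)\log f$ vertices in expectation, and (ii) the fractional chromatic number of $G$ satisfies $\chi_f(G)\le (2+\varepsilon)\Delta/\log f$.
   Context: $\log$ denotes the natural logarithm. A fractional colouring of $G$ is an assignment $w$ of pairwise disjoint Lebesgue-measurable subsets of $\mathbb{R}$ to the independent sets of $G$ such that for every vertex $v$, $\sum_{I\ni v}\mu(w(I))\ge 1$ (where $\mu$ is Lebesgue measure); its total weight is $\sum_I \mu(w(I))$, and the fractional chromatic number $\chi_f(G)$ is the minimum total weight of a fractional colouring of $G$. *)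

(* Defs.v *)
From HB Require Import structures.
From mathcomp Require Import all_boot all_order all_algebra.
From mathcomp Require Import all_classical all_reals all_analysis.
Set Implicit Arguments. Unset Strict Implicit. Unset Printing Implicit Defensive.
Import Order.TTheory GRing.Theory Num.Theory.
Local Open Scope classical_set_scope.
Local Open Scope ring_scope.

Definition simple_graph (T : finType) (e : rel T) : Prop :=
  symmetric e /\ irreflexive e.

Definition nbhd (T : finType) (e : rel T) (v : T) : {set T} := [set u | e v u].

Definition deg (T : finType) (e : rel T) (v : T) : nat := #|nbhd e v|.

Definition max_degree_is (T : finType) (e : rel T) (D : nat) : Prop :=
  (forall v, deg e v <= D)%N /\ (exists v, deg e v = D).

Definition induced_edges (T : finType) (e : rel T) (S : {set T}) : nat :=
  #|[set E : {set T} | (E \subset S) &&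
      [exists u, exists w, (E == (u |: [set w])%SET) && e u w]]|.

Definition indep (T : finType) (e : rel T) (I : {set T}) : bool :=
  [forall u, forall w, (u \in I) ==> (w \in I) ==> ~~ e u w].

Definition exp_indep_size (R : realType) (T : finType) (e : rel T) : R :=
  (\sum_(I : {set T} | indep e I) (#|I|%:R : R)) /
  (#|[set I : {set T} | indep e I]|%:R).

Definition frac_colouring (R : realType) (T : finType) (e : rel T)
    (w : {set T} -> set R) : Prop :=
  [/\ (forall I, indep e I -> measurable (w I)),
      (forall I J, indep e I -> indep e J -> I != J -> w I `&` w J = set0) &
      (forall v : T, (1 <= \sum_(I : {set T} | indep e I && (v \in I))
                             (@lebesgue_measure R) (w I))%E)].

Definition frac_weight (R : realType) (T : finType) (e : rel T)
    (w : {set T} -> set R) : \bar R :=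
  (\sum_(I : {set T} | indep e I) (@lebesgue_measure R) (w I))%E.

Definition frac_chromatic (R : realType) (T : finType) (e : rel T) : \bar R :=
  ereal_inf [set frac_weight e w | w in [set w | frac_colouring e w]].

(* Main.v *)
(* Both parts follow from one local inequality for the hard-core model of a small
   fugacity lam.  Let I be a random independent set of weight lam^|I|, and condition
   on the part of I outside the closed neighbourhood of v: then either v \in I, or I
   restricts to a hard-core set on an induced subgraph F of N(v), with partition
   function Z.  With lam = dl * sqrt f / D the edge hypothesis gives
   lam^2 e(F) <= dl^2.  A union bound then shows that the expected size of a
   hard-core set in F is at least (lam |F| - 2 lam^2 e(F)) / (1 + lam), while
   Z <= exp (lam |F|).  Hence, with K = (1/2 - dl) ln f, either Z <= exp K or the
   expected size is at least about K, and in both cases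
     beta * P(v \in I) + gamma * E|I :&: N(v)| >= 1
   for beta = 1 + exp K / lam and gamma = (1 + lam) / (K - 2 dl^2).  Here
   beta + gamma D <= (2 + eps) D / ln f for f large.
   Summing over v bounds E|I| at fugacity lam, hence at fugacity 1, since the
   expected size increases with the fugacity.  As the inequality holds in every
   induced subgraph, a greedy fractional colouring has weight at most
   beta + gamma D. *)
Require Import Defs.
From HB Require Import structures.
From mathcomp Require Import all_boot all_order all_algebra.
From mathcomp Require Import all_classical all_reals all_analysis.
From mathcomp Require Import lra ring.
Set Implicit Arguments. Unset Strict Implicit. Unset Printing Implicit Defensive.
Import Order.TTheory GRing.Theory Num.Theory.
Local Open Scope classical_set_scope.
Local Open Scope ring_scope.

(** * The hard-core model on induced subgraphs *)

Section HardCore.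
Variables (R : realType) (T : finType) (e : rel T).
Hypotheses (esym : symmetric e) (eirr : irreflexive e).

Lemma indepP (I : {set T}) :
  reflect {in I &, forall u w, ~~ e u w} (indep e I).
Proof.
apply: (iffP 'forall_forallP) => h u w; last first.
  by apply/implyP => uI; apply/implyP => wI; apply: h.
by move=> uI wI; have := h u w; rewrite uI wI.
Qed.

Lemma indep_subset (I J : {set T}) : I \subset J -> indep e J -> indep e I.
Proof.
by move=> /fintype.subsetP IJ /indepP h; apply/indepP => u w /IJ uJ /IJ wJ; apply: h.
Qed.

Lemma indep0 : indep e finset.set0.
Proof. by apply/indepP => u w; rewrite finset.inE. Qed.

Lemma indepU (A J : {set T}) :
  indep e (A :|: J) =
  [&& indep e A, indep e J & [forall u in A, forall w in J, ~~ e u w]].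
Proof.
apply/indepP/and3P => [h | [/indepP hA /indepP hJ /forall_inP hAJ] u w].
  split.
  - by apply/indepP => u w uA wA; apply: h; rewrite finset.inE ?uA ?wA.
  - by apply/indepP => u w uA wA; apply: h; rewrite finset.inE ?uA ?wA orbT.
  - apply/forall_inP => u uA; apply/forall_inP => w wJ.
    by apply: h; rewrite finset.inE ?uA ?wJ ?orbT.
rewrite !finset.inE => /orP[uA|uJ] /orP[wA|wJ].
- exact: hA.
- exact: (forall_inP (hAJ _ uA)).
- by rewrite esym; apply: (forall_inP (hAJ _ wA)).
- exact: hJ.
Qed.

Lemma indepU1 (u : T) (I : {set T}) :
  indep e (u |: I) = indep e I && [disjoint nbhd e u & I].
Proof.
rewrite indepU andbA; congr (_ && _).
  case: (indep e I); rewrite ?andbF ?andbT //.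
  by apply/indepP => x y; rewrite !finset.inE => /eqP-> /eqP->; rewrite eirr.
apply/forall_inP/pred0P => [h w | h w].
  apply/negbTE/negP; rewrite /= finset.inE => /andP[euw wI].
  by have /forall_inP/(_ w wI) := h u (finset.set11 u); rewrite euw.
rewrite finset.inE => /eqP->; apply/forall_inP => x xI.
by have := h x; rewrite /= finset.inE xI andbT => ->.
Qed.

(* [hcpart lam S] and [occ lam S u] are the partition function of the hard-core
   model of fugacity [lam] on the subgraph induced by [S], and its restriction to
   the independent sets containing [u]; [occ / hcpart] is the occupation
   probability of [u]. *)
Definition hcpart (lam : R) (S : {set T}) : R :=
  \sum_(I : {set T} | indep e I && (I \subset S)) lam ^+ #|I|.

Definition occ (lam : R) (S : {set T}) (u : T) : R :=
  \sum_(I : {set T} | indep e I && (I \subset S) && (u \in I)) lam ^+ #|I|.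

Definition avoid (lam : R) (S : {set T}) (u : T) : R :=
  \sum_(I : {set T} | indep e I && (I \subset S) && [disjoint nbhd e u & I])
    lam ^+ #|I|.

Variable lam : R.
Hypothesis lam_gt0 : 0 < lam.

Let lamX_ge0 (n : nat) : 0 <= lam ^+ n. Proof. exact/exprn_ge0/ltW. Qed.

Lemma hcpart_gt0 (S : {set T}) : 0 < hcpart lam S.
Proof.
rewrite /hcpart (bigD1 finset.set0) /=; last by rewrite indep0 finset.sub0set.
by rewrite finset.cards0 expr0 ltr_wpDr// sumr_ge0.
Qed.

Lemma occ_ge0 (S : {set T}) (u : T) : 0 <= occ lam S u.
Proof. exact: sumr_ge0. Qed.

(** Inserting [u] matches the sets counted by [avoid] that miss [u] with those that contain it, at
    the cost of a factor [lam]; by independence the latter are exactly the sets counted by [occ]. *)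
Lemma avoid_occ (S : {set T}) (u : T) : u \in S ->
  lam * avoid lam S u = (1 + lam) * occ lam S u.
Proof.
move=> uS; rewrite /avoid (bigID (fun I : {set T} => u \in I)) /= mulrDr mulrDl mul1r addrC.
congr (_ + _).
  rewrite /occ [RHS](reindex_onto (fun I => u |: I) (fun I => I :\ u)) /=; last first.
    by move=> I /andP[_ uI]; rewrite finset.setD1K.
  rewrite big_distrr /=; apply: eq_big => [I | I /andP[_ uI]].
    rewrite indepU1 finset.subUset finset.sub1set uS finset.setU11 andbT.
    have -> : ((u |: I) :\ u == I) = (u \notin I).
      apply/eqP/idP => [<- | uI]; first by rewrite finset.setD11.
      by rewrite finset.setU1K.
    by case: (indep e I); case: ([disjoint nbhd e u & I]%B); case: (I \subset S); case: (u \in I).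
  by rewrite finset.cardsU1 uI exprD expr1.
congr (_ * _); apply: eq_bigl => I.
rewrite -!andbA; case iI: (indep e I) => //=; case: (I \subset S) => //=.
case uI: (u \in I); rewrite ?andbF //= andbT.
apply/pred0P => w /=; apply/negbTE/negP; rewrite finset.inE => /andP[euw wI].
by move/indepP: iI => /(_ u w uI wI); rewrite euw.
Qed.

Lemma occ_le (S : {set T}) (u : T) : u \in S -> occ lam S u <= lam * hcpart lam S.
Proof.
move=> uS.
have h : avoid lam S u <= hcpart lam S.
  rewrite /hcpart (bigID (fun I : {set T} => [disjoint nbhd e u & I]%B)) /=.
  by rewrite lerDl sumr_ge0.
apply: (le_trans _ (ler_wpM2l (ltW lam_gt0) h)).
by rewrite avoid_occ// mulrDl mul1r lerDl mulr_ge0 ?occ_ge0// ltW.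
Qed.

(* A union bound over the neighbours of [u]. *)
Lemma occ_ge (S : {set T}) (u : T) : u \in S ->
  lam * hcpart lam S * (1 - lam * #|nbhd e u :&: S|%:R) <= (1 + lam) * occ lam S u.
Proof.
move=> uS; rewrite -avoid_occ// -mulrA ler_pM2l//.
have h : hcpart lam S <= avoid lam S u + \sum_(w in nbhd e u :&: S) occ lam S w.
  rewrite /hcpart (bigID (fun I : {set T} => [disjoint nbhd e u & I]%B)) /= lerD2l.
  rewrite /occ (exchange_big_dep (fun I : {set T} => indep e I && (I \subset S))) /=; last first.
    by move=> w I _ /andP[].
  rewrite [leRHS](bigID (fun I : {set T} => [disjoint nbhd e u & I]%B)) /= addrC ler_wpDr//.
    by apply: sumr_ge0 => I _; apply: sumr_ge0.
  apply: ler_sum => I /andP[/andP[iI IS] /pred0Pn[w /andP[/= nw wI]]].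
  rewrite (bigD1 w) /=; last by rewrite finset.inE nw (fintype.subsetP IS) // iI IS wI.
  by rewrite lerDl sumr_ge0.
have h2 : \sum_(w in nbhd e u :&: S) occ lam S w <= \sum_(w in nbhd e u :&: S) lam * hcpart lam S.
  by apply: ler_sum => w; rewrite finset.inE => /andP[_ wS]; apply: occ_le.
rewrite sumr_const -mulr_natr in h2; lra.
Qed.

Lemma sum_occ (A S : {set T}) : \sum_(u in A) occ lam S u =
  \sum_(I : {set T} | indep e I && (I \subset S)) #|I :&: A|%:R * lam ^+ #|I|.
Proof.
rewrite /occ (exchange_big_dep (fun I : {set T} => indep e I && (I \subset S))) /=; last first.
  by move=> w I _ /andP[].
apply: eq_bigr => I -> /=; rewrite sumr_const mulr_natl; congr (_ *+ _).
by apply: eq_card => u; rewrite !finset.inE andbC.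
Qed.

(** Dropping the independence condition turns the sum into [(1 + lam) ^+ #|S|]. *)
Lemma hcpart_le_expR (S : {set T}) : hcpart lam S <= expR (lam * #|S|%:R).
Proof.
have h : hcpart lam S <= (1 + lam) ^+ #|S|.
  have -> : (1 + lam) ^+ #|S| = \sum_(I : {set T} | I \subset S) lam ^+ #|I|.
    (* Vertices outside [S] contribute the summand 0, so that only subsets of [S] survive when the
       product is expanded. *)
    have -> : (1 + lam) ^+ #|S| = \prod_(i : T) ((if i \in S then lam else 0) + 1).
      rewrite -prodr_const big_mkcond; apply: eq_bigr => i _ /=.
      by case: ifP => _; rewrite ?add0r// addrC.
    rewrite bigA_distr [RHS]big_mkcond; apply: eq_bigr => I _ /=.
    rewrite -big_mkcond /=; case: ifPn => [/fintype.subsetP IS | /subsetPn[i iI iS]].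
      rewrite -prodr_const; apply: eq_bigr => i iI; first by rewrite IS.
    by rewrite (bigD1 i)//= (negbTE iS) mul0r.
  rewrite /hcpart [leRHS](bigID (indep e)) /=.
  rewrite [X in X + _](eq_bigl (fun I => indep e I && (I \subset S))).
    by rewrite lerDl sumr_ge0.
  by move=> I; rewrite andbC.
apply: (le_trans h); rewrite mulrC expRM_natl lerXn2r ?nnegrE ?expR_ge0//.
  by rewrite addr_ge0 // ltW.
exact: expR_ge1Dx.
Qed.

End HardCore.

(** * The local occupancy inequality *)

Section LocalOccupancy.
Variables (R : realType) (T : finType) (e : rel T).
Hypotheses (esym : symmetric e) (eirr : irreflexive e).

(** The left side counts ordered adjacent pairs in [F]; forgetting the order sends them to edges
    inside [S], at most two to one. *)
Lemma sum_deg_le (F S : {set T}) : F \subset S ->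
  (\sum_(u in F) #|nbhd e u :&: F| <= 2 * induced_edges e S)%N.
Proof.
move=> FS; pose P := [set p : T * T | [&& p.1 \in F, p.2 \in F & e p.1 p.2]]%SET.
have -> : (\sum_(u in F) #|nbhd e u :&: F| = #|P|)%N.
  rewrite -sum1_card (partition_big fst (mem F)) /=; last first.
    by move=> p; rewrite finset.inE => /and3P[].
  apply: eq_bigr => u uF; rewrite sum1_card.
  rewrite -(card_imset (nbhd e u :&: F) (f := pair u)); last by move=> x y [].
  apply: eq_card => -[x y]; rewrite [RHS]unfold_in /= [in RHS]finset.inE /=.
  apply/imsetP/idP => [[w wF [-> ->]]|].
    move: wF; rewrite !finset.inE => /andP[euw wF].
    by rewrite uF wF euw eqxx.
  by move=> /andP[/and3P[xF yF exy] /eqP xu]; exists y; rewrite ?xu// !finset.inE -xu exy.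
(* [induced_edges] takes the cardinal of a classical set; [Ed] is the same family as a finite
   set. *)
pose Ed : {set {set T}} := finset (fun E : {set T} => (E \subset S) &&
      [exists u, exists w, (E == (u |: [set w])%SET) && e u w]).
have -> : induced_edges e S = #|Ed|.
  by apply: eq_card => E; rewrite finset.inE; apply/idP/idP; rewrite in_setE.
rewrite -sum1_card (partition_big (fun p => p.1 |: [set p.2]%SET) (mem Ed)) /=; last first.
  move=> [x y]; rewrite !finset.inE /= => /and3P[xF yF exy].
  rewrite finset.subUset !finset.sub1set !(fintype.subsetP FS)//=.
  by apply/existsP; exists x; apply/existsP; exists y; rewrite eqxx.
rewrite mulnC -sum_nat_const; apply: leq_sum => E.
rewrite finset.inE => /andP[_ /existsP[u /existsP[w /andP[/eqP-> euw]]]].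
rewrite sum1_card; apply: leq_trans (_ : #|[set (u, w); (w, u)]%SET| <= 2)%N; last first.
  by rewrite cards2; case: (_ != _).
apply/subset_leq_card/fintype.subsetP => -[x y]; rewrite unfold_in /= [X in X && _]finset.inE /= !finset.inE /=.
move=> /andP[/and3P[_ _ exy] /eqP h].
have : x \in (u |: [set w])%SET by rewrite -h finset.set21.
have : y \in (u |: [set w])%SET by rewrite -h finset.set22.
rewrite !finset.inE => /orP[]/eqP yE /orP[]/eqP xE; move: exy; rewrite xE yE ?eirr// => _;
  by rewrite eqxx ?orbT.
Qed.

Variable lam : R.
Hypothesis lam_gt0 : 0 < lam.

Lemma sum_occ_ge (F S : {set T}) : F \subset S ->
  lam * hcpart e lam F * (#|F|%:R - 2 * lam * (induced_edges e S)%:R)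
    <= (1 + lam) * \sum_(u in F) occ e lam F u.
Proof.
move=> FS; rewrite [leRHS]mulr_sumr.
apply: (@le_trans _ _
  (\sum_(u in F) lam * hcpart e lam F * (1 - lam * #|nbhd e u :&: F|%:R))); last first.
  by apply: ler_sum => u uF; apply: occ_ge.
rewrite -mulr_sumr ler_pM2l; last by rewrite mulr_gt0// hcpart_gt0.
rewrite sumrB -mulr_sumr sumr_const -natr_sum -mulrA mulrCA -natrM lerD2l lerN2.
by rewrite ler_pM2l// ler_nat sum_deg_le.
Qed.

(** Let Z be [hcpart e lam F]; the inequality is scaled by lam + Z, the total weight given the
    outside part. If [lam * #|F|%:R <= K], then Z is at most [expR K] and the [beta] term alone
    suffices. Otherwise [sum_occ_ge] makes the [gamma] term at least Z, and [beta >= 1] pays for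
    [lam]. *)
Lemma local_occupancy (F S : {set T}) (beta gamma K c : R) : F \subset S ->
  1 <= beta -> 0 <= gamma ->
  lam ^+ 2 * (induced_edges e S)%:R <= c ->
  expR K <= lam * (beta - 1) -> 1 + lam <= gamma * (K - 2 * c) ->
  lam + hcpart e lam F <= beta * lam + gamma * \sum_(u in F) occ e lam F u.
Proof.
move=> FS b1 g0 hc hK hg.
set M := \sum_(u in F) _; have M0 : 0 <= M by apply: sumr_ge0 => u _; apply: occ_ge0.
have Z0 := hcpart_gt0 e lam_gt0 F.
have gM0 : 0 <= gamma * M by exact: mulr_ge0.
have [dK|dK] := leP (lam * #|F|%:R) K.
  rewrite -ler_expR in dK.
  have hZ : hcpart e lam F <= lam * (beta - 1).
    exact: le_trans (le_trans (hcpart_le_expR e lam_gt0 F) dK) hK.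
  lra.
have hM := sum_occ_ge FS; rewrite -/M in hM.
suff h : hcpart e lam F <= gamma * M.
  have bl : 0 <= (beta - 1) * lam by rewrite mulr_ge0 ?subr_ge0// ltW.
  lra.
have l1 : 0 < 1 + lam by rewrite addr_gt0.
rewrite -(ler_pM2l l1) [leRHS]mulrCA; apply: le_trans (ler_wpM2l g0 hM).
set m := (induced_edges e S)%:R in hc *.
set d := (#|F|%:R : R) in dK *.
have -> : gamma * (lam * hcpart e lam F * (d - 2 * lam * m)) =
  hcpart e lam F * (gamma * (lam * d - 2 * (lam ^+ 2 * m))) by ring.
rewrite mulrC ler_pM2l//; apply: (le_trans hg); apply: ler_wpM2l => //; lra.
Qed.

(* Given [A], the part of [I] outside the closed neighbourhood of [v], either
   [I = v |: A] or [I] is [A] together with an independent set of neighbours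
   of [v] having no neighbour in [A]. *)
Lemma sum_indep_outside (S A : {set T}) (v : T) (g : {set T} -> R) :
  v \in S -> indep e A -> A \subset S -> [disjoint A & v |: nbhd e v]%B ->
  \sum_(I : {set T} | indep e I && (I \subset S) && (I :\: (v |: nbhd e v) == A)) g I
  = g (v |: A) +
    \sum_(J : {set T} | indep e J &&
      (J \subset [set u in nbhd e v :&: S | [disjoint nbhd e u & A]%B]%SET)) g (A :|: J).
Proof.
move=> vS iA AS dA.
have vA : v \notin A by rewrite (disjointFl dA)// finset.setU11.
have AN u : u \in A -> ~~ e v u.
  by move=> uA; have := disjointFr dA uA; rewrite !finset.inE => /norP[].
rewrite (bigID (fun I : {set T} => v \in I)) /=; congr (_ + _).
  rewrite (big_pred1 (v |: A))// => I.
  apply/andP/eqP => [[/andP[/andP[iI IS] /eqP<-] vI]|->].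
    apply/finset.setP => u; rewrite !finset.inE; case: eqVneq => [->//|uv] /=.
    by case uI: (u \in I); rewrite ?andbF// (negbTE (indepP _ _ iI v u vI uI)).
  rewrite indepU1// iA finset.subUset finset.sub1set vS AS finset.setU11.
  split=> //; apply/andP; split; [rewrite !andbT|].
    by apply/pred0P => u /=; rewrite finset.inE; case uA: (u \in A); rewrite ?andbF// (negbTE (AN _ uA)).
  apply/eqP/finset.setP => u; rewrite !finset.inE.
  case: eqVneq => [->|_] /=; first by rewrite (negbTE vA).
  by case uA: (u \in A); rewrite ?andbF// (AN _ uA).
rewrite (reindex_onto (fun J => A :|: J) (fun I => I :&: nbhd e v)) /=; last first.
  move=> I /andP[/andP[_ /eqP<-] vI]; apply/finset.setP => u; rewrite !finset.inE.
  by case: eqVneq => [->|_]; [rewrite (negbTE vI)|case: (e v u); case: (u \in I)].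
apply: eq_bigl => J; apply/idP/idP.
  move=> /andP[/andP[/andP[/andP[iAJ AJS] _] vAJ] /eqP JE].
  move: iAJ; rewrite indepU// => /and3P[_ iJ /forall_inP hAJ]; rewrite iJ.
  apply/fintype.subsetP => u uJ; rewrite !finset.inE.
  have /finset.setIP[_] : u \in (A :|: J) :&: nbhd e v by rewrite JE.
  rewrite finset.inE => -> /=; rewrite (fintype.subsetP AJS) ?finset.inE ?uJ ?orbT//=.
  apply/pred0P => w /=; rewrite finset.inE; case wA: (w \in A); rewrite ?andbF//.
  by rewrite esym (negbTE (forall_inP (hAJ w wA) u uJ)).
move=> /andP[iJ /fintype.subsetP hJ].
have JS u : u \in J -> [/\ e v u, u \in S & forall w, w \in A -> ~~ e u w].
  move=> /hJ; rewrite !finset.inE => /andP[/andP[-> ->] /pred0P h]; split=> // w wA.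
  by have := h w; rewrite /= finset.inE wA andbT => ->.
rewrite indepU// iA iJ finset.subUset AS /=.
have -> : [forall u in A, forall w in J, ~~ e u w].
  apply/forall_inP => u uA; apply/forall_inP => w /JS[_ _ /(_ u uA)].
  by rewrite esym.
have -> : J \subset S by apply/fintype.subsetP => u /JS[].
have vJ : v \notin J by apply/negP => /JS[]; rewrite eirr.
rewrite finset.inE (negbTE vA) (negbTE vJ) /= andbT; apply/andP; split; apply/eqP/finset.setP => u; rewrite !finset.inE.
  case: eqVneq => [->|_] /=; first by rewrite (negbTE vA).
  case uA: (u \in A) => /=; first by rewrite AN.
  by case uJ: (u \in J); rewrite ?andbF//; have [->] := JS u uJ.
case uJ: (u \in J); first by have [->] := JS u uJ; rewrite orbT.
by case uA: (u \in A); rewrite //= (negbTE (AN _ uA)).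
Qed.

(** Both sides are split according to the part [A] of the independent set outside the closed
    neighbourhood of [v]. For each [A] what remains is the local inequality times [lam ^+ #|A|]. *)
Lemma occupancy_ge (S : {set T}) (v : T) (beta gamma : R) : v \in S ->
  (forall F : {set T}, F \subset nbhd e v ->
    lam + hcpart e lam F <= beta * lam + gamma * \sum_(u in F) occ e lam F u) ->
  hcpart e lam S <= beta * occ e lam S v + gamma * \sum_(u in nbhd e v) occ e lam S u.
Proof.
move=> vS hloc; pose N := v |: nbhd e v.
pose Q (A : {set T}) := [&& indep e A, A \subset S & [disjoint A & N]%B].
have QI (I : {set T}) : indep e I && (I \subset S) -> Q (I :\: N).
  move=> /andP[iI IS]; apply/and3P; split.
  - exact: indep_subset (finset.subsetDl _ _) iI.
  - exact: fintype.subset_trans (finset.subsetDl _ _) IS.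
  - by apply/pred0P => u /=; rewrite finset.in_setD; case: (u \in N); rewrite //= andbF.
have hocc : occ e lam S v = \sum_(I : {set T} | indep e I && (I \subset S))
    (v \in I)%:R * lam ^+ #|I|.
  rewrite [RHS](bigID (fun I : {set T} => v \in I)) /= [X in _ + X]big1 ?addr0.
    by apply: eq_bigr => I /andP[_ ->]; rewrite mul1r.
  by move=> I /andP[_ /negbTE->]; rewrite mul0r.
rewrite sum_occ hocc !mulr_sumr -big_split /= /hcpart.
rewrite (partition_big _ Q QI) [leRHS](partition_big _ Q QI) /=.
apply: ler_sum => A /and3P[iA AS dA]; rewrite !sum_indep_outside//.
have vA : v \notin A by rewrite (disjointFl dA)// finset.setU11.
have AN u : u \in A -> ~~ e v u.
  by move=> uA; have := disjointFr dA uA; rewrite !finset.inE => /norP[].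
(* The neighbours of [v] still available once [A] is fixed; [F] varies with [A], which is why [hloc]
   ranges over all subsets of the neighbourhood. *)
pose F : {set T} := [set u in nbhd e v :&: S | [disjoint nbhd e u & A]%B]%SET.
have FN : F \subset nbhd e v.
  by apply/fintype.subsetP => u; rewrite !finset.inE => /andP[/andP[]].
have AF (J : {set T}) : J \subset F -> [/\ v \notin J, #|A :|: J| = (#|A| + #|J|)%N & (A :|: J) :&: nbhd e v = J :&: F].
  move=> JF; have JN u : u \in J -> e v u.
    by move=> uJ; have := fintype.subsetP FN u (fintype.subsetP JF u uJ); rewrite finset.inE.
  split.
  - by apply/negP => /JN; rewrite eirr.
  - rewrite finset.cardsU (_ : A :&: J = finset.set0) ?finset.cards0 ?subn0//.
    apply/finset.setP => u; rewrite !finset.inE; case uJ: (u \in J); rewrite ?andbF// andbT.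
    by apply/negbTE/negP => /AN; rewrite JN.
  - rewrite (finset.setIidPl JF); apply/finset.setP => u; rewrite !finset.inE.
    case uJ: (u \in J); first by rewrite orbT JN.
    by case uA: (u \in A); rewrite //= (negbTE (AN u uA)).
rewrite -/F finset.setU11 mul1r finset.cardsU1 vA.
rewrite (_ : (v |: A) :&: nbhd e v = finset.set0) ?finset.cards0 ?mul0r ?mulr0 ?addr0; last first.
  apply/finset.setP => u; rewrite !finset.inE; case: eqVneq => [->|_] /=; first by rewrite eirr.
  by case uA: (u \in A); rewrite //= (negbTE (AN u uA)).
rewrite exprD expr1.
rewrite [X in _ + X <= _](eq_bigr (fun J : {set T} => lam ^+ #|A| * lam ^+ #|J|)); last first.
  by move=> J /andP[_ /AF[_ -> _]]; rewrite exprD.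
rewrite [X in _ <= _ + X](eq_bigr (fun J : {set T} => lam ^+ #|A| * (gamma * (#|J :&: F|%:R * lam ^+ #|J|)))); last first.
  move=> J /andP[_ /AF[/negbTE vJ -> ->]]; rewrite finset.inE (negbTE vA) vJ /= mul0r mulr0 add0r exprD.
  by ring.
rewrite -!mulr_sumr.
have := hloc F FN; rewrite sum_occ -/(hcpart e lam F) => h.
have := ler_wpM2l (exprn_ge0 #|A| (ltW lam_gt0)) h; lra.
Qed.

End LocalOccupancy.

(** * Averaging over vertices and passing to the uniform distribution *)

Section Averaging.
Variables (R : realType) (T : finType) (e : rel T).
Hypothesis (esym : symmetric e).

Lemma sum_nbhd_le (D : nat) (x : T -> R) : (forall v, deg e v <= D)%N ->
  (forall v, 0 <= x v) ->
  \sum_(v : T) \sum_(u in nbhd e v) x u <= D%:R * \sum_(v : T) x v.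
Proof.
move=> hD x0; rewrite (exchange_big_dep predT)//= mulr_sumr; apply: ler_sum => u _.
rewrite (eq_bigl (mem (nbhd e u))); last by move=> v; rewrite /= !finset.inE esym.
by rewrite sumr_const -[leLHS]mulr_natl ler_wpM2r// ler_nat; apply: hD.
Qed.

(* Chebyshev's sum inequality: [|I|] and [lam ^+ |I|] are oppositely ordered. *)
Lemma chebyshev_card (lam : R) : 0 <= lam <= 1 ->
  (\sum_(I : {set T} | indep e I) #|I|%:R * lam ^+ #|I|) *
    (\sum_(I : {set T} | indep e I) 1) <=
  (\sum_(I : {set T} | indep e I) #|I|%:R) *
    (\sum_(I : {set T} | indep e I) lam ^+ #|I|).
Proof.
move=> lam01.
(* This symmetric double sum is twice the difference of the two sides, and each of its terms is
   nonnegative. *)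
suff h : 0 <= \sum_(I : {set T} | indep e I) \sum_(J : {set T} | indep e J)
    (#|I|%:R - #|J|%:R : R) * (lam ^+ #|J| - lam ^+ #|I|).
  have e1 : \sum_(I : {set T} | indep e I) \sum_(J : {set T} | indep e J)
    (#|I|%:R - #|J|%:R : R) * (lam ^+ #|J| - lam ^+ #|I|) =
    2 * ((\sum_(I : {set T} | indep e I) #|I|%:R) *
    (\sum_(I : {set T} | indep e I) lam ^+ #|I|)) -
    2 * ((\sum_(I : {set T} | indep e I) #|I|%:R * lam ^+ #|I|) *
    (\sum_(I : {set T} | indep e I) 1)).
    have sp (a b : {set T} -> R) : \sum_(I : {set T} | indep e I) \sum_(J : {set T} | indep e J) a I * b J
      = (\sum_(I : {set T} | indep e I) a I) * (\sum_(J : {set T} | indep e J) b J).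
      by rewrite big_distrlr.
    transitivity (\sum_(I : {set T} | indep e I) \sum_(J : {set T} | indep e J)
       (#|I|%:R * lam ^+ #|J| + lam ^+ #|I| * #|J|%:R - (#|I|%:R * lam ^+ #|I|) * 1 - 1 * (#|J|%:R * lam ^+ #|J|))).
      by apply: eq_bigr => I _; apply: eq_bigr => J _; ring.
    under eq_bigr => I _ do rewrite !big_split /= !sumrN.
    rewrite !big_split /= !sumrN !sp; ring.
  by rewrite e1 subr_ge0 ler_pM2l in h.
apply: sumr_ge0 => I _; apply: sumr_ge0 => J _.
case/andP: lam01 => l0 l1.
have [IJ|/ltnW JI] := leqP #|I| #|J|.
  by rewrite mulr_le0// subr_le0 ?ler_nat// ler_wiXn2l.
by rewrite mulr_ge0// subr_ge0 ?ler_nat// ler_wiXn2l.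
Qed.

(** Summing the hypothesis over [v] bounds the mean size at fugacity [lam] from below, since each
    vertex lies in at most [D] neighbourhoods. [chebyshev_card] then carries the bound to fugacity
    1. *)
Lemma exp_indep_size_ge (lam beta gamma : R) (D : nat) :
  0 < lam <= 1 -> 0 <= gamma -> (forall v, deg e v <= D)%N ->
  (forall v, hcpart e lam [set: T]%SET <= beta * occ e lam [set: T]%SET v
     + gamma * \sum_(u in nbhd e v) occ e lam [set: T]%SET u) ->
  0 <= beta ->
  #|T|%:R <= (beta + gamma * D%:R) * exp_indep_size R e.
Proof.
move=> /andP[l0 l1] g0 hD hocc b0.
pose Z := \sum_(I : {set T} | indep e I) lam ^+ #|I|.
pose N : R := \sum_(I : {set T} | indep e I) 1.
pose M := \sum_(I : {set T} | indep e I) #|I|%:R * lam ^+ #|I|.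
have hZ : hcpart e lam [set: T]%SET = Z.
  by apply: eq_bigl => I; rewrite finset.subsetT andbT.
have hM : \sum_v occ e lam [set: T]%SET v = M.
  rewrite (eq_bigl (mem [set: T]%SET)); last by move=> v; rewrite /= finset.inE.
  rewrite sum_occ; apply: eq_big => [I|I _]; first by rewrite finset.subsetT andbT.
  by rewrite finset.setIT.
have Z0 : 0 < Z by rewrite -hZ; apply: hcpart_gt0.
have hN : N = #|[set I : {set T} | indep e I]|%:R.
  rewrite /N -[X in _ = X%:R]sum1_card natr_sum; apply: eq_bigl => I.
  by apply/idP/idP; rewrite in_setE.
have N0 : 0 < N.
  rewrite /N (bigD1 finset.set0) ?indep0//= ltr_pwDl// sumr_ge0//.
have h1 : #|T|%:R * Z <= (beta + gamma * D%:R) * M.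
  rewrite mulrDl -mulrA -hM mulr_natl.
  apply: (@le_trans _ _ (\sum_v (beta * occ e lam [set: T]%SET v
     + gamma * \sum_(u in nbhd e v) occ e lam [set: T]%SET u))).
    by rewrite -sumr_const -hZ; apply: ler_sum => v _; apply: hocc.
  rewrite big_split /= -!mulr_sumr lerD2l ler_wpM2l// sum_nbhd_le// => v.
  exact: occ_ge0.
rewrite /exp_indep_size -hN mulrA ler_pdivlMr// -(ler_pM2r Z0).
rewrite mulrAC; apply: (le_trans (ler_wpM2r (ltW N0) h1)).
rewrite -!mulrA ler_wpM2l ?addr_ge0 ?mulr_ge0//.
by apply: chebyshev_card; rewrite ltW.
Qed.

(** * Fractional colourings from occupancy bounds *)

Definition coverage (x : {set T} -> R) (v : T) : R :=
  \sum_(I : {set T} | indep e I && (v \in I)) x I.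

Lemma coverageD (x p : {set T} -> R) (t : R) (v : T) :
  coverage (fun I => x I + t * p I) v = coverage x v + t * coverage p v.
Proof. by rewrite /coverage big_split /= mulr_sumr. Qed.

(* Greedy fractional colouring: on the set [S] of vertices that are not yet fully
   covered, use the distribution [p S] until some vertex of [S] becomes fully
   covered. *)
Lemma greedy_coverage (beta gamma : R) (D : nat) (p : {set T} -> {set T} -> R) :
  0 <= beta -> 0 <= gamma -> (forall v, deg e v <= D)%N ->
  (forall S I, 0 <= p S I) ->
  (forall S, \sum_(I : {set T} | indep e I) p S I = 1) ->
  (forall (S : {set T}) v, v \notin S -> coverage (p S) v = 0) ->
  (forall (S : {set T}) v, v \in S ->
    1 <= beta * coverage (p S) v + gamma * \sum_(u in nbhd e v) coverage (p S) u) ->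
  exists x : {set T} -> R, [/\ forall I, 0 <= x I, forall v, 1 <= coverage x v &
    \sum_(I : {set T} | indep e I) x I <= beta + gamma * D%:R].
Proof.
move=> b0 g0 hD p0 p1 pS hp.
pose tot (x : {set T} -> R) := \sum_(I : {set T} | indep e I) x I.
have loc_le x v : (forall v, coverage x v <= 1) ->
    beta * coverage x v + gamma * \sum_(u in nbhd e v) coverage x u <= beta + gamma * D%:R.
  move=> x1; apply: lerD; first by rewrite ler_piMr.
  rewrite ler_wpM2l//; apply: (@le_trans _ _ (\sum_(u in nbhd e v) 1)).
    exact: ler_sum.
  by rewrite sumr_const ler_nat; apply: hD.
(* Loop invariant: no vertex is overcovered, those outside [S] are exactly covered, and the local
   inequality bounds [tot x] at each vertex of [S]. The global bound is kept separately because the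
   local one is vacuous once [S] is empty. *)
suff H (n : nat) (S : {set T}) x : (#|S| <= n)%N -> (forall I, 0 <= x I) ->
    (forall v, coverage x v <= 1) -> (forall v, v \notin S -> coverage x v = 1) ->
    (forall v, v \in S -> tot x <= beta * coverage x v + gamma * \sum_(u in nbhd e v) coverage x u) ->
    tot x <= beta + gamma * D%:R ->
    exists y : {set T} -> R, [/\ forall I, 0 <= y I, forall v, 1 <= coverage y v &
      tot y <= beta + gamma * D%:R].
  have c0 v : coverage (fun=> 0) v = 0 by rewrite /coverage big1.
  have t0 : tot (fun=> 0) = 0 by rewrite /tot big1.
  apply: (H #|T| [set: T]%SET (fun=> 0)) => //.
  - exact: max_card.
  - by move=> v; rewrite c0.
  - by move=> v; rewrite finset.inE.
  - by move=> v _; rewrite c0 t0 mulr0 add0r big1 ?mulr0.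
  - by rewrite t0 addr_ge0// mulr_ge0.
elim: n S x => [|n IH] S x Sn x0 x1 xS hx tx.
  exists x; split=> // v; rewrite xS//.
  by move: Sn; rewrite leqn0 cards_eq0 => /eqP->; rewrite finset.inE.
have [S0|[v0 v0S]] := finset.set_0Vmem S.
  by exists x; split=> // v; rewrite xS// S0 finset.inE.
have P0 v : 0 <= coverage (p S) v by apply: sumr_ge0.
(* Otherwise [hp] at [v0] would read [1 <= 0]. *)
have [w0 w0P] : exists w, 0 < coverage (p S) w.
  apply/existsP; apply: contraT => /existsPn h.
  have Pe v : coverage (p S) v = 0 by apply/eqP; rewrite eq_le P0 andbT leNgt h.
  by have := hp S v0 v0S; rewrite Pe mulr0 add0r big1 ?mulr0 ?ler10// => u _.
(* [t v] is the amount of [p S] that saturates [v]; [w] is a vertex saturated first. *)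
pose t v := (1 - coverage x v) / coverage (p S) v.
pose w := [arg min_(v < w0 | 0 < coverage (p S) v) t v]%O.
have [wP wmin] : 0 < coverage (p S) w /\ forall v, 0 < coverage (p S) v -> t w <= t v.
  by rewrite /w; case: arg_minP.
have wS : w \in S by apply: contraLR wP => /pS->; rewrite ltxx.
have t0 : 0 <= t w by rewrite divr_ge0// subr_ge0.
pose y I := x I + t w * p S I.
have cy v : coverage y v = coverage x v + t w * coverage (p S) v by exact: coverageD.
have ty : tot y = tot x + t w by rewrite /tot big_split /= -mulr_sumr p1 mulr1.
have y1 v : coverage y v <= 1.
  rewrite cy -lerBrDl; have [vP|vP] := ltP 0 (coverage (p S) v).
    by rewrite -ler_pdivlMr// wmin.
  by rewrite (_ : coverage (p S) v = 0) ?mulr0 ?subr_ge0//; apply/eqP; rewrite eq_le vP P0.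
have hy v : v \in S -> tot y <= beta * coverage y v + gamma * \sum_(u in nbhd e v) coverage y u.
  move=> vS; rewrite ty cy (eq_bigr _ (fun u _ => cy u)) big_split /= -mulr_sumr.
  have h1 := hx v vS; have := ler_wpM2l t0 (hp S v vS).
  rewrite mulr1 => h2; apply: (le_trans (lerD h1 h2)); rewrite le_eqVlt; apply/orP; left; apply/eqP; ring.
apply: (IH (S :\ w) y) => //.
- by move: Sn; rewrite (cardsD1 w) wS.
- by move=> I; rewrite addr_ge0// mulr_ge0.
- move=> v; rewrite !finset.inE negb_and negbK => /orP[/eqP->|vS].
    by rewrite cy /t divfK ?gt_eqF// addrC subrK.
  by rewrite cy xS// pS// mulr0 addr0.
- by move=> v; rewrite !finset.inE => /andP[_ vS]; apply: hy.
(* Since [w] is still in [S] during this round, the local bound at [w] with all coverages at most 1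
   yields the global one. *)
- exact: le_trans (hy w wS) (loc_le _ _ y1).
Qed.

(** The weights become measurable sets by laying half-open intervals of lengths [x I] end to end, in
    the order of [enum_rank]. *)
Lemma frac_chromatic_le (x : {set T} -> R) (C : R) : (forall I, 0 <= x I) ->
  (forall v, 1 <= coverage x v) -> \sum_(I : {set T} | indep e I) x I <= C ->
  (frac_chromatic R e <= C%:E)%E.
Proof.
move=> x0 xc xC.
pose s (I : {set T}) := \sum_(J : {set T} | (enum_rank J < enum_rank I)%N) x J.
pose w (I : {set T}) : set R := `[s I, s I + x I[%classic.
have mw I : lebesgue_measure (w I) = (x I)%:E.
  rewrite /w lebesgue_measure_itv /= lte_fin ltrDl.
  have [xI|xI] := ltP 0 (x I); first by rewrite -EFinD addrC addKr.
  by congr EFin; apply/eqP; rewrite eq_le x0.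
apply: (@le_trans _ _ (frac_weight e w)); last first.
  by rewrite /frac_weight (eq_bigr _ (fun I _ => mw I)) sumEFin lee_fin.
apply: ereal_inf_lbound; exists w => //; split.
- by move=> I _; apply: measurable_itv.
- have sle I J : (enum_rank I < enum_rank J)%N -> s I + x I <= s J.
    move=> IJ; rewrite /s [leRHS](bigD1 I)//= [leRHS]addrC lerD2r.
    rewrite [leRHS](bigID (fun K => (enum_rank K < enum_rank I)%N)) /= ler_wpDr ?sumr_ge0//.
    rewrite le_eqVlt; apply/orP; left; apply/eqP/eq_bigl => K.
    case: ltnP => KI; rewrite ?andbF// andbT (ltn_trans KI IJ) /=.
    by symmetry; apply: contraTneq KI => ->; rewrite -leqNgt leqnn.
  move=> I J _ _ IJ; apply/seteqP; split=> // r [] /=; rewrite /w /= !in_itv /=.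
  move=> /andP[h1 h2] /andP[h3 h4].
  have : enum_rank I != enum_rank J by apply: contra IJ => /eqP/enum_rank_inj->.
  rewrite -val_eqE neq_ltn => /orP[/sle h|/sle h]; lra.
- move=> v; rewrite (eq_bigr _ (fun I _ => mw I)) sumEFin lee_fin; exact: xc.
Qed.

End Averaging.

(** * Both bounds for general parameters *)

Lemma hard_core_bounds (R : realType) (T : finType) (e : rel T) (D : nat)
    (lam beta gamma K c : R) :
  simple_graph e -> (forall v, deg e v <= D)%N ->
  0 < lam <= 1 -> 1 <= beta -> 0 <= gamma ->
  (forall v, lam ^+ 2 * (induced_edges e (nbhd e v))%:R <= c) ->
  expR K <= lam * (beta - 1) -> 1 + lam <= gamma * (K - 2 * c) ->
  #|T|%:R <= (beta + gamma * D%:R) * exp_indep_size R e /\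
  (frac_chromatic R e <= (beta + gamma * D%:R)%:E)%E.
Proof.
move=> [esym eirr] hD lam01 b1 g0 hc hK hg.
have /andP[l0 l1] := lam01.
have b0 : 0 <= beta by exact: le_trans b1.
have hocc (S : {set T}) v : v \in S ->
    hcpart e lam S <= beta * occ e lam S v + gamma * \sum_(u in nbhd e v) occ e lam S u.
  move=> vS; apply: occupancy_ge => // F FN.
  exact: (local_occupancy esym eirr l0 FN b1 g0 (hc v) hK hg).
split.
  by apply: (exp_indep_size_ge esym lam01) => // v; apply: hocc; rewrite finset.inE.
(* The hard-core distribution on [S]; its coverage of a vertex is the occupation probability. *)
pose p (S I : {set T}) := (if I \subset S then lam ^+ #|I| else 0) / hcpart e lam S.
have Z0 (S : {set T}) := hcpart_gt0 e l0 S.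
have cp (S : {set T}) v : coverage e (p S) v = occ e lam S v / hcpart e lam S.
  rewrite /coverage /p -mulr_suml -big_mkcondr; congr (_ / _).
  by apply: eq_bigl => I; rewrite andbAC.
have [|S|S v vS|S v vS|x [x0 xc xC]] := @greedy_coverage R T e beta gamma D p b0 g0 hD.
- move=> S I; rewrite /p divr_ge0 ?(ltW (Z0 S))//.
  by case: ifP => // _; rewrite exprn_ge0// ltW.
- by rewrite /p -mulr_suml -big_mkcondr; apply: divff (lt0r_neq0 (Z0 S)).
- rewrite cp /occ big1 ?mul0r// => I /andP[/andP[_ IS] vI].
  by rewrite (fintype.subsetP IS) in vS.
- rewrite cp (eq_bigr _ (fun u _ => cp S u)) -mulr_suml !mulrA -mulrDl.
  by rewrite ler_pdivlMr// mul1r hocc.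
- exact: (frac_chromatic_le x0 xc xC).
Qed.

(** * Numerical estimates for the parameters *)

Lemma expR_ge_sqr (R : realType) (x : R) : 0 <= x -> x ^+ 2 / 4 <= expR x.
Proof.
move=> x0; have -> : x = x / 2 + x / 2 by lra.
rewrite expRD; have := expR_ge1Dx (x / 2).
set y := expR _ => hy; nra.
Qed.

(** [L] stands for [ln f] and [s] for the square root of [f]. Multiplied by [L], the three summands
    are at most [dl * D], [dl * D] and [(2 + 24 * dl) * D]. The terms [32 / dl] and [4 / dl ^+ 4] in
    the bound on [L] serve the first two. *)
Lemma weight_bound (R : realType) (dl L s D : R) :
  0 < dl <= 1 / 8 -> 32 / dl + 4 / dl ^+ 4 + 1 <= L -> s = expR (L / 2) ->
  0 < D -> s <= 2 * D ->
  let lam := dl * s / D in let K := (1 / 2 - dl) * L in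
  0 < K - 2 * dl ^+ 2 /\
  1 + expR K / lam + (1 + lam) / (K - 2 * dl ^+ 2) * D <= (2 + 26 * dl) * D / L.
Proof.
move=> /andP[dl0 dl1] hL hs D0 sD lam K.
have a0 : 0 < 32 / dl by rewrite divr_gt0.
have a1 : 0 < 4 / dl ^+ 4 by rewrite divr_gt0// exprn_gt0.
have L1 : 1 <= L by lra.
have L0 : 0 < L by lra.
have s0 : 0 < s by rewrite hs expR_gt0.
have lam0 : 0 < lam by rewrite divr_gt0// mulr_gt0.
have lamle : lam <= 2 * dl by rewrite ler_pdivrMr//; nra.
have KL : (1 / 2 - 2 * dl) * L <= K - 2 * dl ^+ 2 by rewrite /K expr2; nra.
have KL0 : 0 < (1 / 2 - 2 * dl) * L by rewrite mulr_gt0//; lra.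
have K0 : 0 < K - 2 * dl ^+ 2 by exact: lt_le_trans KL.
split=> //.
(* From [L ^+ 2 / 16 <= s <= 2 * D] and [32 / dl <= L]. *)
have h1 : L <= dl * D.
  have := expR_ge_sqr (ltW (divr_gt0 L0 (ltr0Sn R 1))); rewrite -hs => h.
  have : 32 / dl <= L by lra.
  rewrite ler_pdivrMr// => h'; have : L ^+ 2 <= 32 * D by lra.
  rewrite expr2 => h''; rewrite -(ler_pM2l L0); nra.
(* The factor [s] in [lam] cancels [expR (L / 2)], leaving the decay [expR (- dl * L)], which beats
   any fixed power of [L]. *)
have h2 : L * (expR K / lam) <= dl * D.
  have -> : expR K / lam = D / dl / expR (dl * L).
    rewrite /K mulrBl expRB (_ : 1 / 2 * L = L / 2) ?mul1r 1?mulrC// -hs /lam.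
    by field; rewrite !gt_eqF// expR_gt0.
  have := expR_ge_sqr (ltW (mulr_gt0 dl0 L0)).
  set E := expR _ => hE.
  have E0 : 0 < E by exact: expR_gt0.
  have h4 : 4 <= L * dl ^+ 4 by rewrite -ler_pdivrMr ?exprn_gt0//; lra.
  have h3 : L <= dl ^+ 2 * E.
    apply: (@le_trans _ _ (dl ^+ 2 * ((dl * L) ^+ 2 / 4))).
      rewrite (_ : dl ^+ 2 * _ = (L * dl ^+ 4) * L / 4); last by field.
      by rewrite ler_pdivlMr// mulrC ler_wpM2r// ltW.
    by rewrite ler_wpM2l// exprn_ge0// ltW.
  rewrite (_ : L * _ = L * D / (dl * E)); last by field; rewrite !gt_eqF.
  rewrite ler_pdivrMr ?mulr_gt0//.
  have := ler_wpM2r (ltW D0) h3; lra.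
have h3 : L * ((1 + lam) / (K - 2 * dl ^+ 2) * D) <= (2 + 24 * dl) * D.
  rewrite mulrA ler_wpM2r ?(ltW D0)// mulrA ler_pdivrMr//.
  (* The constant 24 gives [1 + 2 * dl <= (2 + 24 * dl) * (1 / 2 - 2 * dl)] exactly when
     [dl <= 1 / 8], as [dl > 0]. *)
  apply: (@le_trans _ _ ((2 + 24 * dl) * ((1 / 2 - 2 * dl) * L))); last first.
    by rewrite ler_wpM2l//; lra.
  by rewrite mulrA mulrC ler_wpM2r ?(ltW L0)//; nra.
rewrite ler_pdivlMr// mulrC !mulrDr mulr1; lra.
Qed.

Theorem theorem1p2 (R : realType) (eps : R) (heps : 0 < eps) :
  exists f0 : R, forall (f : R) (D : nat) (T : finType) (e : rel T),
    (0 < D)%N ->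
    f0 <= f -> f <= (D ^ 2 + 1)%:R ->
    simple_graph e ->
    max_degree_is e D ->
    (forall v : T, (induced_edges e (nbhd e v))%:R <= (D ^ 2)%:R / f) ->
    ((1 / 2 - eps) * (#|T|%:R / D%:R) * ln f <= exp_indep_size R e) /\
    (frac_chromatic R e <= ((2 + eps) * D%:R / ln f)%:E)%E.
Proof.
pose dl := Num.min (1 / 8) (eps / 26).
have dl0 : 0 < dl by rewrite lt_min !divr_gt0.
have dl8 : dl <= 1 / 8 by rewrite ge_min lexx.
have dleps : 26 * dl <= eps by rewrite mulrC -ler_pdivlMr// ge_min lexx orbT.
pose L0 : R := 32 / dl + 4 / dl ^+ 4 + 1.
have L01 : 1 <= L0 by rewrite lerDr ltW// addr_gt0// divr_gt0// exprn_gt0.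
exists (expR L0) => f D T e Dn hf0 hf sg [hD _] hm.
have f0 : 0 < f := lt_le_trans (expR_gt0 _) hf0.
have D1 : 1 <= D%:R :> R by rewrite ler1n.
have D0 : 0 < D%:R :> R by rewrite ltr0n.
set L := ln f.
have LL : L0 <= L by rewrite -ler_expR lnK.
have Lp : 0 < L by apply: lt_le_trans LL; apply: lt_le_trans L01.
pose s := expR (L / 2).
have sp : 0 < s by exact: expR_gt0.
have s2 : s ^+ 2 = f.
  by rewrite -expRM_natl -[RHS](lnK f0) -/L; congr expR; field.
(* Here [f <= D ^ 2 + 1] enters; it keeps [lam] at most 1. *)
have sD : s <= 2 * D%:R.
  rewrite -(@ler_pXn2r _ 2) ?nnegrE ?(ltW sp)// ?mulr_ge0// s2.
  by apply: (le_trans hf); rewrite natrD natrX; nra.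
have [] := @weight_bound R dl L s D%:R _ LL erefl D0 sD; first by rewrite dl0 dl8.
set lam := dl * s / D%:R; set K := (1 / 2 - dl) * L => K0 hw.
have lam0 : 0 < lam by rewrite divr_gt0// mulr_gt0.
have lam1 : lam <= 1 by rewrite ler_pdivrMr//; nra.
pose beta := 1 + expR K / lam.
pose gamma := (1 + lam) / (K - 2 * dl ^+ 2).
have hbg : beta + gamma * D%:R <= (2 + eps) * D%:R / L.
  by apply: (le_trans hw); rewrite -!mulrA ler_wpM2r ?divr_ge0 ?(ltW Lp)//; lra.
have g0 : 0 <= gamma by rewrite divr_ge0 ?(ltW K0)// addr_ge0// ltW.
have [] := @hard_core_bounds R T e D lam beta gamma K (dl ^+ 2) sg hD.
- by rewrite lam0.
- by rewrite lerDl divr_ge0 ?expR_ge0// ltW.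
- exact: g0.
- move=> v; apply: (le_trans (ler_wpM2l (exprn_ge0 2 (ltW lam0)) (hm v))).
  rewrite -s2 natrX le_eqVlt; apply/orP; left; apply/eqP; rewrite /lam; field.
  by rewrite !gt_eqF.
- by rewrite /beta addrAC subrr add0r mulrCA divff ?mulr1// gt_eqF.
- by rewrite /gamma divfK// gt_eqF.
move=> hE hF; split; last by apply: (le_trans hF); rewrite lee_fin.
have E0 : 0 <= exp_indep_size R e by rewrite /exp_indep_size divr_ge0// sumr_ge0.
have h := le_trans hE (ler_wpM2r E0 hbg).
(* For [eps > 1 / 2] the claimed lower bound is at most 0. *)
have [eh|eh] := leP eps (1 / 2); last first.
  apply: le_trans E0; rewrite -mulrA mulr_le0_ge0//; first lra.
  by rewrite mulr_ge0 ?divr_ge0// ltW.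
have hq : #|T|%:R / D%:R * L <= (2 + eps) * exp_indep_size R e.
  rewrite mulrAC ler_pdivrMr// -ler_pdivlMr//; apply: (le_trans h).
  by rewrite le_eqVlt; apply/orP; left; apply/eqP; field; rewrite gt_eqF.
have e2 : 0 <= 1 / 2 - eps by lra.
rewrite -mulrA; apply: (le_trans (ler_wpM2l e2 hq)).
(* [(1 / 2 - eps) * (2 + eps) = 1 - 3 / 2 * eps - eps ^+ 2], which is at most 1. *)
by rewrite mulrA ler_piMl//; nra.
Qed.
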